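(* Let $k\in\mathbb{N}$ and $x\in\mathbb{R}$ with $|kx|<1$, and let $s\in\mathbb{C}$ with $\operatorname{Re}(s)>1$. Then $$\zeta(s)\,\zeta_{1,\mathrm{even}}(x:k,s)=\frac{Li_s(k^2x^2)-Li_s(kx)}{2^s-1},$$ where $\zeta$ is the Riemann zeta function.
   Context: For $k,n\in\mathbb{N}$ and $x\in\mathbb{R}$ define $L_k(x:n)=\frac{1}{n}\sum_{d\mid n}\mu\!\left(\frac{n}{d}\right)k^dx^d$, where $\mu$ is the Möbius function. Define $\zeta_{1,\mathrm{even}}(x:k,s)=\sum_{n=1}^{\infty}\frac{L_k(x:2n)}{(2n)^{s-1}}$. The polylogarithm is $Li_s(z)=\sum_{n=1}^{\infty}\frac{z^n}{n^s}$. *)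

(* Defs.v *)
From HB Require Import structures.
From mathcomp Require Export all_boot all_order all_algebra.
From mathcomp Require Export complex.
From mathcomp Require Export all_classical all_reals all_analysis.
Set Implicit Arguments.
Unset Strict Implicit.
Unset Printing Implicit Defensive.
Import Order.TTheory GRing.Theory Num.Theory.
Export numFieldNormedType.Exports.

Local Open Scope ring_scope.
Local Open Scope complex_scope.

(* The Moebius function; mobius 0 = 0 is a convention. *)
Definition mobius (n : nat) : int :=
  if (0 < n)%N && all (fun p => logn p n == 1%N) (primes n)
  then (-1) ^+ size (primes n) else 0.

Definition Lpoly (R : realType) (k : nat) (x : R) (n : nat) : R :=
  n%:R^-1 * \sum_(d <- divisors n) (mobius (n %/ d))%:~R * k%:R ^+ d * x ^+ d.

Definition cexp (R : realType) (z : R[i]) : R[i] :=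
  (expR (complex.Re z))%:C *
  (cos (complex.Im z) +i* sin (complex.Im z)).

(* n ^ s with the principal (real) logarithm of n; meaningful for 0 < n. *)
Definition natcpow (R : realType) (n : nat) (s : R[i]) : R[i] :=
  cexp (s * (ln (n%:R : R))%:C).

(* Series indexed from n = 1, for the topology of the norm on R[i], which
   the library attaches to the alias R[i]^o. If the series diverges, csum is
   an unspecified value. *)
Definition csum_cvg (R : realType) (u : nat -> R[i]) : Prop :=
  cvgn (series (fun n => u n.+1 : R[i]^o)).

Definition csum (R : realType) (u : nat -> R[i]) : R[i] :=
  limn (series (fun n => u n.+1 : R[i]^o)).

Definition zeta_term (R : realType) (s : R[i]) (n : nat) : R[i] :=
  (natcpow n s)^-1.

(* The Riemann zeta function on the half-plane 1 < Re s. *)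
Definition zeta (R : realType) (s : R[i]) : R[i] := csum (zeta_term s).

Definition polylog_term (R : realType) (s z : R[i]) (n : nat) : R[i] :=
  z ^+ n / natcpow n s.

Definition polylog (R : realType) (s z : R[i]) : R[i] :=
  csum (polylog_term s z).

Definition zeta1_even_term (R : realType) (x : R) (k : nat) (s : R[i])
    (n : nat) : R[i] :=
  (Lpoly k x (2 * n))%:C / natcpow (2 * n) (s - 1).

Definition zeta1_even (R : realType) (x : R) (k : nat) (s : R[i]) : R[i] :=
  csum (zeta1_even_term x k s).

(* Main.v *)
(* Write y = k x and a(n) = sum_(d | n) mu(n/d) y^d, so that
   sum_(d | n) a(d) = y^n by Moebius inversion, and let E = zeta_(1,even) =
   sum_(n even) a(n) n^(-s). Multiplying Dirichlet series gives
     zeta(s) E     = sum_n n^(-s) sum_(d | n, d even) a(d),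
     2^s zeta(s) E = sum_n n^(-s) sum_(d | n) a(2 d).
   The even divisors of 2 n are the 2 d with d | n, and a divisor of 2 n that
   does not divide n is even, so the difference of the two inner sums is
   sum_(d | 2 n) a(d) - sum_(d | n) a(d) = y^(2 n) - y^n. This yields
   (2^s - 1) zeta(s) E = Li_s(y^2) - Li_s(y) without inverting zeta. *)
Require Import Defs.
From mathcomp Require Import zify ring lra.
Set Implicit Arguments.
Unset Strict Implicit.
Unset Printing Implicit Defensive.
Import Order.TTheory GRing.Theory Num.Theory.
Local Open Scope classical_set_scope.
Local Open Scope ring_scope.
Local Open Scope complex_scope.

(** * Moebius inversion *)

(** If [p] divides [n], its valuation in [p * n] is at least 2; otherwise the list of primes gains
    exactly [p], which flips the sign. *)
Lemma mobius_primeM (p n : nat) : prime p -> (0 < n)%N ->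
  mobius (p * n) = if (p %| n)%N then 0 else - mobius n.
Proof.
move=> pp n0; have p0 := prime_gt0 pp.
rewrite /mobius muln_gt0 p0 n0 /=; case: (boolP (p %| n)%N) => pn.
  case: ifPn => // /allP /(_ p).
  rewrite primesM // primes_prime // inE eqxx lognM // logn_prime // eqxx => /(_ isT).
  by have := logn_gt0 p n; rewrite mem_primes pp n0 pn; lia.
have pN : p \notin primes n by rewrite mem_primes pp n0.
have primesE : perm_eq (primes (p * n)) (p :: primes n).
  apply: uniq_perm; rewrite ?primes_uniq //= ?primes_uniq ?pN // => q.
  by rewrite primesM // primes_prime // !inE.
rewrite (perm_all _ primesE) (perm_size primesE) /= exprS mulN1r.
rewrite lognM // logn_prime // eqxx (_ : logn p n = 0%N) /=; last first.
  by apply/eqP; rewrite -leqn0 leqNgt logn_gt0.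
rewrite (@eq_in_all _ _ (fun q => logn q n == 1%N)) => [|q qn].
  by case: ifP; rewrite ?oppr0.
rewrite lognM // logn_prime // (_ : q == p = false) //.
by apply/eqP => qp; rewrite -qp qn in pN.
Qed.

Lemma perm_divisors_multiples (n d : nat) : (0 < n)%N -> (d %| n)%N ->
  perm_eq [seq m <- divisors n | d %| m]%N [seq (d * e)%N | e <- divisors (n %/ d)].
Proof.
move=> n0 dn; have d0 := dvdn_gt0 n0 dn.
have nd0 : (0 < n %/ d)%N by rewrite divn_gt0 // dvdn_leq.
apply: uniq_perm; first by rewrite filter_uniq // divisors_uniq.
  by rewrite map_inj_uniq ?divisors_uniq // => a b /eqP; rewrite eqn_pmul2l // => /eqP.
move=> m; rewrite mem_filter -dvdn_divisors //; apply/andP/mapP => [[dm mn]|[e]].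
  exists (m %/ d)%N; last by rewrite mulnC divnK.
  by rewrite -dvdn_divisors // dvdn_divRL // divnK.
by rewrite -dvdn_divisors // dvdn_divRL // mulnC => en ->; rewrite dvdn_mulr // mulnC.
Qed.

Lemma sum_divisors_multiples (V : nmodType) (n d : nat) (F : nat -> V) :
  (0 < n)%N -> (d %| n)%N ->
  \sum_(m <- divisors n | (d %| m)%N) F m =
  \sum_(e <- divisors (n %/ d)) F (d * e)%N.
Proof.
by move=> n0 dn; rewrite -big_filter (perm_big _ (perm_divisors_multiples n0 dn)) big_map.
Qed.

Lemma perm_divisors_sub (n m : nat) : (0 < n)%N -> (m %| n)%N ->
  perm_eq (divisors m) [seq d <- divisors n | d %| m]%N.
Proof.
move=> n0 mn; have m0 := dvdn_gt0 n0 mn.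
apply: uniq_perm; rewrite ?filter_uniq ?divisors_uniq // => d.
rewrite mem_filter -!dvdn_divisors //; case: (boolP (d %| m)%N) => //= dm.
by rewrite (dvdn_trans dm).
Qed.

(** For [n > 1] and a prime [p] dividing [n], the divisors [p * e] contribute [- mobius e] when [p]
    does not divide [e] and 0 otherwise, which cancels the divisors prime to [p]. *)
Lemma sum_mobius (n : nat) : (0 < n)%N ->
  \sum_(d <- divisors n) mobius d = (n == 1)%N%:R.
Proof.
rewrite leq_eqVlt => /predU1P[<-|n1]; first by rewrite (_ : divisors 1 = [:: 1%N]) // big_seq1.
rewrite gtn_eqF //=; have pp := pdiv_prime n1; set p := pdiv n in pp.
have [n0 p0] := (ltnW n1, prime_gt0 pp).
have pn : (p %| n)%N := pdiv_dvd n.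
have np0 : (0 < n %/ p)%N by rewrite divn_gt0 // dvdn_leq.
rewrite (bigID (fun d => p %| d)%N) /= sum_divisors_multiples //.
have -> : \sum_(e <- divisors (n %/ p)) mobius (p * e) =
   - \sum_(e <- divisors (n %/ p) | ~~ (p %| e)%N) mobius e.
  rewrite -sumrN [RHS]big_mkcond; apply: eq_big_seq => e.
  rewrite -dvdn_divisors // => en.
  by rewrite mobius_primeM // ?(dvdn_gt0 np0) //; case: ifP.
apply/eqP; rewrite addrC subr_eq0; apply/eqP.
rewrite -[LHS]big_filter -[RHS]big_filter; apply: perm_big; apply: uniq_perm;
  rewrite ?filter_uniq ?divisors_uniq // => d.
rewrite !mem_filter -!dvdn_divisors //; case: (boolP (p %| d)%N) => //= pd.
(* Since [p] divides [n] and is coprime to [d], [p * d] divides [n] iff [d] does. *)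
rewrite dvdn_divRL // mulnC Gauss_dvd ?pn //.
by rewrite prime_coprime.
Qed.

(** After exchanging the sums and writing [m = d * e], the coefficient of [F d] is the sum of
    [mobius] over the divisors of [n %/ d], which vanishes unless [d = n]. *)
Lemma mobius_inversion (A : comNzRingType) (F : nat -> A) (n : nat) : (0 < n)%N ->
  \sum_(m <- divisors n) \sum_(d <- divisors m) (mobius (m %/ d))%:~R * F d = F n.
Proof.
move=> n0.
transitivity (\sum_(m <- divisors n) \sum_(d <- divisors n | (d %| m)%N)
   (mobius (m %/ d))%:~R * F d).
  apply: eq_big_seq => m; rewrite -dvdn_divisors // => mn.
  by rewrite (perm_big _ (perm_divisors_sub n0 mn)) big_filter.
rewrite (exchange_big_dep predT) //=.
transitivity (\sum_(d <- divisors n) (n %/ d == 1)%N%:R * F d).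
  apply: eq_big_seq => d; rewrite -dvdn_divisors // => dn.
  have d0 := dvdn_gt0 n0 dn.
  rewrite sum_divisors_multiples // -mulr_suml; congr (_ * _).
  rewrite (eq_bigr (fun e => (mobius e)%:~R)) => [|e _]; last by rewrite mulKn.
  have nd0 : (0 < n %/ d)%N by rewrite divn_gt0 // dvdn_leq.
  have /(congr1 (fun z : int => z%:~R : A)) := sum_mobius nd0.
  by rewrite rmorph_sum /= => ->; case: eqP.
rewrite (bigD1_seq n) ?divisors_id ?divisors_uniq //= divnn n0 mul1r big1_seq ?addr0 //.
move=> d /andP[dn]; rewrite -dvdn_divisors // => dvd.
case: eqP => [n1|]; last by rewrite mul0r.
by move: dn; rewrite -{1}(divnK dvd) n1 mul1n eqxx.
Qed.

(* Every divisor of 2n that does not divide n is even. *)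
Lemma sum_even_divisors (V : zmodType) (a : nat -> V) (n : nat) : (0 < n)%N ->
  \sum_(d <- divisors n) a (2 * d)%N - \sum_(d <- divisors n | ~~ odd d) a d =
  \sum_(d <- divisors (2 * n)) a d - \sum_(d <- divisors n) a d.
Proof.
move=> n0; have n20 : (0 < 2 * n)%N by rewrite muln_gt0.
have evenE m : ~~ odd m = (2 %| m)%N by rewrite dvdn2.
rewrite [X in _ = X - _](bigID (fun d => 2 %| d)%N) /=.
have -> : \sum_(d <- divisors (2 * n) | (2 %| d)%N) a d = \sum_(d <- divisors n) a (2 * d)%N.
  by rewrite sum_divisors_multiples ?dvdn_mulr // mulKn.
rewrite [X in _ = _ - X](bigID (fun d => 2 %| d)%N) /=.
under [X in _ - X = _]eq_bigl do rewrite evenE.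
have -> : \sum_(d <- divisors (2 * n) | ~~ (2 %| d)%N) a d =
          \sum_(d <- divisors n | ~~ (2 %| d)%N) a d.
  rewrite -[LHS]big_filter -[RHS]big_filter; apply: perm_big; apply: uniq_perm;
    rewrite ?filter_uniq ?divisors_uniq // => d.
  rewrite !mem_filter -!dvdn_divisors //; case: (boolP (2 %| d)%N) => //= d2.
  by rewrite Gauss_dvdr // coprime_sym prime_coprime.
by rewrite [in RHS]opprD addrACA subrr addr0.
Qed.

Lemma norm_mobius_le1 (R : numDomainType) n : `|(mobius n)%:~R| <= 1 :> R.
Proof.
rewrite /mobius; case: ifP => _; last by rewrite normr0.
by rewrite rmorphXn rmorphN1 normrX normrN1 expr1n.
Qed.

(** The divisors are distinct exponents, so a geometric series dominates. The bound is uniform in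
    [n], which makes the coefficients of the Dirichlet series bounded. *)
Lemma norm_sum_mobius_exp_le (R : realFieldType) (y : R) n : `|y| < 1 -> (0 < n)%N ->
  `|\sum_(d <- divisors n) (mobius (n %/ d))%:~R * y ^+ d| <= (1 - `|y|)^-1.
Proof.
move=> y1 n0; have y10 : 0 < 1 - `|y| by rewrite subr_gt0.
apply: (@le_trans _ _ (\sum_(d <- divisors n) `|y| ^+ d)).
  apply: le_trans (ler_norm_sum _ _ _) _; apply: ler_sum => d _.
  by rewrite normrM normrX ler_piMl ?exprn_ge0 // norm_mobius_le1.
rewrite (perm_big [seq d <- index_iota 0 n.+1 | d %| n]%N); last first.
  apply: uniq_perm; rewrite ?filter_uniq ?divisors_uniq ?iota_uniq // => d.
  rewrite mem_filter -dvdn_divisors // mem_index_iota.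
  by case: (boolP (d %| n)%N) => //= dn; rewrite ltnS dvdn_leq.
rewrite big_filter big_mkcond /=.
apply: (@le_trans _ _ (\sum_(0 <= d < n.+1) `|y| ^+ d)).
  by apply: ler_sum => d _; case: ifP => // _; rewrite exprn_ge0.
rewrite -[leRHS]mul1r ler_pdivlMr // mulrC -opprB mulNr big_mkord -subrX1 opprB.
by rewrite gerBl exprn_ge0.
Qed.

(** * Dirichlet series *)

(** Tannery's theorem with a growing range: a fixed head tends to 0 termwise, and the remaining
    block is small by the Cauchy criterion for [M]. *)
Lemma cvg_sum_dominated (K : numFieldType) (u : nat -> nat -> K) (M : nat -> K) :
  (forall N d, `|u N d| <= M d) -> cvgn (series M) ->
  (forall d, u N d @[N --> \oo] --> (0 : K)) ->
  (\sum_(0 <= d < N) u N d) @[N --> \oo] --> (0 : K).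
Proof.
move=> uM cM u0; apply/cvgrPdist_lt => e e0.
have e2 : 0 < e / 2 by rewrite divr_gt0.
move/cvg_cauchy/cauchy_seriesP : cM => /(_ _ e2) [[/= A B] [[a _ aA] [b _ bB]] AB].
(* The Cauchy filter on pairs gives one threshold per endpoint; [m] passes both. *)
pose m := maxn a b.
have tail N : (m <= N)%N -> `|\sum_(m <= d < N) u N d| < e / 2.
  move=> mN; apply: le_lt_trans (AB (m, N) _); last first.
    by split; [apply: aA | apply: bB] => /=; rewrite /m; lia.
  rewrite [leRHS]ger0_norm ?sumr_ge0 // => [|d _]; last exact: le_trans (uM 0%N d).
  by apply: le_trans (ler_norm_sum _ _ _) _; apply: ler_sum.
have head : (\sum_(0 <= d < m) u N d) @[N --> \oo] --> (0 : K).
  elim: m {tail} => [|m IH]; first by rewrite (_ : (fun N => \sum_(0 <= d < 0) u N d) = cst 0);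
    [exact: cvg_cst | apply/funext => N; rewrite big_nil].
  rewrite (_ : (fun N => \sum_(0 <= d < m.+1) u N d) =
    (fun N => \sum_(0 <= d < m) u N d + u N m)).
    have h := cvgD IH (u0 m); rewrite addr0 in h; exact: h.
  by apply/funext => N; rewrite big_nat_recr.
move/cvgrPdist_lt: head => /(_ _ e2) head.
near=> N.
have mN : (m <= N)%N by near: N; exact: nbhs_infty_ge.
rewrite sub0r normrN (big_cat_nat (leq0n m) mN) //= (le_lt_trans (ler_normD _ _)) //.
rewrite [e]splitr ltrD ?tail //.
by rewrite -normrN -sub0r; near: N.
Unshelve. all: by end_near. Qed.

(** Both sides run over the pairs with product at most [N]. In the induction, [N.+1 %/ d.+1] exceeds
    [N %/ d.+1] by one exactly when [d.+1] divides [N.+1]. *)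
Lemma sum_dirichlet (K : pzSemiRingType) (f g : nat -> K) (N : nat) :
  \sum_(0 <= n < N) \sum_(d <- divisors n.+1) f d * g (n.+1 %/ d)%N =
  \sum_(0 <= d < N) f d.+1 * \sum_(0 <= n < N %/ d.+1) g n.+1.
Proof.
elim: N => [|N IH]; first by rewrite !big_nil.
rewrite big_nat_recr //= IH [RHS]big_nat_recr //= divnn /= big_nat1.
have -> : \sum_(d <- divisors N.+1) f d * g (N.+1 %/ d)%N =
   \sum_(0 <= d < N.+1 | (d.+1 %| N.+1)%N) f d.+1 * g (N.+1 %/ d.+1)%N.
  rewrite -(big_add1 _ _ 0 N.+2 (fun d => d %| N.+1)%N (fun d => f d * g (N.+1 %/ d)%N)).
  rewrite -[RHS]big_filter; apply: perm_big; apply: uniq_perm.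
  - exact: divisors_uniq.
  - by rewrite filter_uniq // iota_uniq.
  - move=> d; rewrite -dvdn_divisors // mem_filter mem_index_iota.
    by case: (boolP (d %| N.+1)%N) => //= dN; rewrite (dvdn_gt0 _ dN) //= ltnS dvdn_leq.
rewrite [X in _ + X]big_mkcond big_nat_recr //= dvdnn divnn /= addrA; congr (_ + _).
rewrite -big_split /=; apply: eq_big_nat => d _.
rewrite divnS //; case: (d.+1 %| N.+1)%N; last by rewrite addr0.
by rewrite add1n big_nat_recr //= mulrDr addrC.
Qed.

(* Summing over d first, the N-th partial sum differs from F_N * G by
   sum_(d <= N) f d * (G_(N/d) - G), which tends to 0 by domination, as in
   Mertens' theorem on Cauchy products. *)
Lemma cvg_dirichlet (K : numFieldType) (f g : nat -> K) (F G : K) :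
  cvgn (series (fun n => `|f n.+1|)) ->
  series (fun n => f n.+1) @ \oo --> F ->
  series (fun n => g n.+1) @ \oo --> G ->
  series (fun n => \sum_(d <- divisors n.+1) f d * g (n.+1 %/ d)%N) @ \oo --> F * G.
Proof.
move=> cf fF gG.
have [B B0 gB] : exists2 B : K, 0 <= B & forall n, `|series (fun n => g n.+1) n - G| <= B.
  have /cvg_seq_bounded [C [_ /(_ (C + 1))]] : cvgn (fun n => series (fun n => g n.+1) n - G).
    by apply: is_cvgB; [apply/cvg_ex; exists G | exact: is_cvg_cst].
  rewrite ltrDl ltr01 => /(_ isT) CB; exists (C + 1) => [|n]; last exact: CB.
  exact: le_trans (CB 0%N _).
pose h n := series (fun n => g n.+1) n - G.
have h0 : h n @[n --> \oo] --> (0 : K).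
  by rewrite -(subrr G); apply: cvgB => //; exact: cvg_cst.
pose u N d := f d.+1 * h (N %/ d.+1)%N.
have u0 : (\sum_(0 <= d < N) u N d) @[N --> \oo] --> (0 : K).
  apply: (@cvg_sum_dominated _ _ (fun d => `|f d.+1| * B)).
  - by move=> N d; rewrite normrM; apply: ler_wpM2l; [exact: normr_ge0 | exact: gB].
  - rewrite (_ : series _ = (fun n => series (fun n => `|f n.+1|) n * B)).
      exact: is_cvgMr_tmp.
    by apply/funext => n; rewrite /series/= mulr_suml.
  - move=> d; have hd : h (N %/ d.+1)%N @[N --> \oo] --> (0 : K).
      apply: (cvg_comp (fun N => N %/ d.+1)%N h); last exact: h0.
      (* For fixed [d], [N %/ d.+1] reaches [n] as soon as [N >= n * d.+1]. *)
      move=> A [n _ nA]; exists (n * d.+1)%N => // N /= nN.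
      by apply: nA => /=; rewrite leq_divRL.
    have fhd := cvgMl_tmp (a := f d.+1) hd; rewrite mulr0 in fhd.
    exact: fhd.
rewrite (_ : series _ = (fun N => series (fun n => f n.+1) N * G + \sum_(0 <= d < N) u N d)).
  have fGu := cvgD (cvgMr_tmp (b := G) fF) u0; rewrite addr0 in fGu; exact: fGu.
apply/funext => N; rewrite /series/= sum_dirichlet mulr_suml -big_split/=.
by apply: eq_bigr => d _; rewrite /u /h /series/= mulrBr addrC subrK.
Qed.

(** * Convergence of complex sequences and series *)

(* Stated over K^o, which carries the topology of R[i]; a direct use of
   cvgMl_tmp at R[i]^o makes unification diverge. *)
Lemma cvgMl_regular (K : numFieldType) (u : nat -> K) (a c : K) :
  (u : nat -> K^o) @ \oo --> (a : K^o) ->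
  ((fun n => c * u n) : nat -> K^o) @ \oo --> (c * a : K^o).
Proof. exact: cvgMl_tmp. Qed.

Lemma cvg_complex (R : realType) (u : nat -> R[i]) (a : R[i]) :
  (fun n => complex.Re (u n)) @ \oo --> complex.Re a ->
  (fun n => complex.Im (u n)) @ \oo --> complex.Im a ->
  (u : nat -> R[i]^o) @ \oo --> (a : R[i]^o).
Proof.
have cvgC (v : nat -> R) (b : R) : v @ \oo --> b ->
   (fun n => (v n)%:C : R[i]^o) @ \oo --> (b%:C : R[i]^o).
  move=> /cvgrPdist_lt vb; apply/cvgrPdist_lt => e e0.
  (* A positive element of [R[i]] is real, so the tolerance can be taken in [R]. *)
  have [eR Re0] : e = (complex.Re e)%:C /\ 0 < complex.Re e.
    case: e e0 => x y; rewrite ltcE /= => /andP[/eqP -> ?]; by [].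
  near=> n; rewrite eR -rmorphB normc_def /= expr0n addr0 sqrtr_sqr ltcR.
  by near: n; exact: vb.
move=> /cvgC ua /cvgC ub.
rewrite [a]complexE (_ : u = fun n => (complex.Re (u n))%:C + 'i%C * (complex.Im (u n))%:C).
  exact: cvgD ua (@cvgMl_regular R[i] _ _ _ ub).
by apply/funext => n; rewrite -complexE.
Unshelve. all: by end_near. Qed.

(** Real and imaginary parts are each dominated by [M], so completeness of the reals suffices. *)
Lemma is_cvg_complex_series (R : realType) (u : nat -> R[i]) (M : nat -> R) :
  (forall n, `|u n| <= (M n)%:C) -> cvgn (series M) ->
  cvgn (series (u : nat -> R[i]^o)).
Proof.
move=> uM cM.
have M0 n : 0 <= M n by rewrite -(@lecR R); exact: le_trans (normr_ge0 (u n)) (uM n).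
have cvg_dom (v : nat -> R) : (forall n, `|v n| <= M n) -> cvgn (series v).
  move=> vM; apply: (@normed_cvg R R^o v).
  exact: (series_le_cvg (fun n => normr_ge0 (v n)) M0 vM cM).
have cRe : cvgn (series (fun n => complex.Re (u n))).
  by apply: cvg_dom => n; rewrite -(@lecR R) (le_trans (normc_ge_Re _)).
have cIm : cvgn (series (fun n => complex.Im (u n))).
  apply: cvg_dom => n; rewrite -(@lecR R) (le_trans _ (uM n)) // normc_def lecR.
  by rewrite -sqrtr_sqr ler_wsqrtr // lerDr sqr_ge0.
apply/cvg_ex; exists (limn (series (fun n => complex.Re (u n))) +i*
  limn (series (fun n => complex.Im (u n)))).
apply: cvg_complex => /=.
  by rewrite (_ : (fun n => _) = series (fun n => complex.Re (u n))) //;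
    apply/funext => n; rewrite /series/= raddf_sum.
by rewrite (_ : (fun n => _) = series (fun n => complex.Im (u n))) //;
    apply/funext => n; rewrite /series/= raddf_sum.
Qed.

(** * The complex exponential and the series of real powers *)

Lemma normc_cexp (R : realType) (z : R[i]) :
  `|cexp z| = (expR (complex.Re z))%:C.
Proof.
by rewrite /cexp normrM !normc_def /= cos2Dsin2 sqrtr1 mulr1 expr0n addr0 sqrtr_sqr
  ger0_norm // expR_ge0.
Qed.

Lemma cexpD (R : realType) (z w : R[i]) : cexp (z + w) = cexp z * cexp w.
Proof.
case: z w => [a b] [c d]; rewrite /cexp /= expRD cosD sinD; simpc.
by apply/eqP; rewrite eq_complex /=; apply/andP; split; apply/eqP; ring.
Qed.

(* From [ln ((x + 1) / x) >= 1 / (x + 1)] and [expR u >= 1 + u]. *)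
Lemma powR_telescope (R : realType) (t x : R) : 0 < t -> 0 < x ->
  ((x + 1) `^ (1 + t))^-1 <= ((x `^ t)^-1 - ((x + 1) `^ t)^-1) / t.
Proof.
move=> t0 x0; have y0 : 0 < x + 1 by lra.
have X0 : 0 < x `^ t by apply: powR_gt0.
have Y0 : 0 < (x + 1) `^ t by apply: powR_gt0.
have lnyx : (x + 1)^-1 <= ln (x + 1) - ln x.
  have := @le_ln1Dx R (- (x + 1)^-1).
  rewrite (_ : 1 - (x + 1)^-1 = x / (x + 1)); last by field; rewrite gt_eqF.
  rewrite ln_div ?posrE // ltrN2 invf_lt1 // => /(_ _); lra.
have XY : x `^ t * (1 + t / (x + 1)) <= (x + 1) `^ t.
  rewrite /powR !gt_eqF // -[X in _ <= expR (t * X)](subrK (ln x)).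
  rewrite [t * (_ + ln x)]mulrDr expRD mulrC.
  rewrite ler_pM2r ?expR_gt0 // (le_trans _ (expR_ge1Dx _)) // lerD2l.
  by rewrite ler_wpM2l // ltW.
rewrite powRD ?(gt_eqF y0) ?implybT // (powRr1 (ltW y0)).
move: X0 Y0 XY; set X := x `^ t; set Y := (x + 1) `^ t => X0 Y0 XY.
rewrite -subr_ge0 (_ : _ - _ = (Y - X * (1 + t / (x + 1))) / (X * Y * t)).
  by rewrite divr_ge0 ?subr_ge0 // !mulr_ge0 // ltW.
by field; rewrite !gt_eqF.
Qed.

(** With [t = a - 1], [powR_telescope] bounds all terms after the first by a telescoping sum of
    total at most [t^-1]. *)
Lemma is_cvg_riemannR (R : realType) (a : R) : 1 < a -> cvgn (series (riemannR a)).
Proof.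
move=> a1; pose t := a - 1; have t0 : 0 < t by rewrite subr_gt0.
have r0 n : 0 <= riemannR a n by rewrite ltW // riemannR_gt0; lra.
apply: nondecreasing_is_cvgn; first exact: nondecreasing_series.
exists (1 + t^-1) => _ [n _ <-].
(* Keeping the subtracted remainder of the telescoping sum is what lets the induction close. *)
have bound : series (riemannR a) n.+1 <= 1 + t^-1 - (n.+1%:R `^ t)^-1 / t.
  elim: n => [|n IH].
    by rewrite seriesEnat /= big_nat1 /riemannR !powR1 invr1 mul1r addrK.
  rewrite seriesEnat /= big_nat_recr //=.
  have := powR_telescope t0 (ltr0Sn R n).
  rewrite (_ : 1 + t = a) ?natr1 => [step|]; last by rewrite /t addrC subrK.
  by apply: le_trans (lerD IH step) _; rewrite mulrBl addrA subrK.
apply: (@le_trans _ _ (series (riemannR a) n.+1)).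
  by rewrite seriesEnat /= big_nat_recr //= lerDl.
by apply: le_trans bound _; rewrite gerBl divr_ge0 ?invr_ge0 ?powR_ge0 // ltW.
Qed.

(** * Complex powers of integers and Dirichlet series with bounded coefficients *)

Section natcpow.
Variable R : realType.
Implicit Types (m n : nat) (s : R[i]).

Lemma normc_natcpow n s : (0 < n)%N -> `|natcpow n s| = (n%:R `^ complex.Re s)%:C.
Proof.
move=> n0; rewrite normc_cexp /powR pnatr_eq0 gtn_eqF //.
by case: s => a b /=; rewrite mulr0 subr0.
Qed.

Lemma natcpow_neq0 n s : (0 < n)%N -> natcpow n s != 0.
Proof.
move=> n0; rewrite -normr_eq0 normc_natcpow // eq_complex /= eqxx andbT.
by rewrite gt_eqF // powR_gt0 // ltr0n.
Qed.

Lemma natcpowM m n s : (0 < m)%N -> (0 < n)%N ->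
  natcpow (m * n) s = natcpow m s * natcpow n s.
Proof.
by move=> m0 n0; rewrite /natcpow natrM lnM ?posrE ?ltr0n // rmorphD mulrDr cexpD.
Qed.

(** Lets the factor [n^-1] of [Lpoly] cancel against the exponent [s - 1]. *)
Lemma natcpowB1 n s : (0 < n)%N -> natcpow n (s - 1) = natcpow n s / n%:R.
Proof.
move=> n0; rewrite /natcpow mulrBl cexpD; congr (_ * _).
rewrite mul1r -rmorphN /cexp /= cos0 sin0 mulr1 expRN lnK ?posrE ?ltr0n //.
by rewrite fmorphV rmorph_nat.
Qed.

Lemma normc_dirichlet_term_le (c : nat -> R[i]) (C : R) s n :
  (forall m, (0 < m)%N -> `|c m| <= C%:C) ->
  `|c n.+1 / natcpow n.+1 s| <= (C * riemannR (complex.Re s) n)%:C.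
Proof.
move=> cC; rewrite normrM normfV normc_natcpow // -fmorphV rmorphM ler_wpM2r ?cC //.
by rewrite lecR invr_ge0 powR_ge0.
Qed.

(** Comparison with the series of [n ^ - Re s]. Absolute convergence is recorded too because
    [cvg_dirichlet] asks it of its first factor. *)
Lemma is_cvg_dirichlet_series (c : nat -> R[i]) (C : R) s :
  1 < complex.Re s -> (forall n, (0 < n)%N -> `|c n| <= C%:C) ->
  csum_cvg (fun n => c n / natcpow n s) /\
  csum_cvg (fun n => `|c n / natcpow n s|).
Proof.
move=> s1 cC; have cR : cvgn (series (fun n => C * riemannR (complex.Re s) n)).
  rewrite (_ : (fun n => _) = C *: riemannR (complex.Re s)) //.
  exact/is_cvg_seriesZ/is_cvg_riemannR.
split; apply: (is_cvg_complex_series _ cR) => n; rewrite ?normr_id;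
  exact: normc_dirichlet_term_le.
Qed.

(** Multiplicativity of [natcpow] makes the denominators at [d] and [n %/ d] combine, so multiplying
    by zeta sums coefficients over divisors. *)
Lemma sum_dirichlet_natcpow (c : nat -> R[i]) s n : (0 < n)%N ->
  \sum_(d <- divisors n) c d / natcpow d s * zeta_term s (n %/ d) =
  (\sum_(d <- divisors n) c d) / natcpow n s.
Proof.
move=> n0; rewrite mulr_suml; apply: eq_big_seq => d; rewrite -dvdn_divisors // => dn.
have d0 := dvdn_gt0 n0 dn; have nd0 : (0 < n %/ d)%N by rewrite divn_gt0 // dvdn_leq.
by rewrite -{2}(divnK dn) mulnC natcpowM // -mulrA -invfM.
Qed.

(** The modulus is [2 ^ Re s], which is 1 only when [Re s = 0]. *)
Lemma natcpow2_neq1 s : 1 < complex.Re s -> natcpow 2 s != 1.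
Proof.
move=> s1; apply/eqP => /(congr1 (fun z : R[i] => `|z|)).
rewrite normc_natcpow // normr1 => /(congr1 (@complex.Re R)) /= /eqP.
rewrite powR_eq1 => /or3P[]; lra.
Qed.

End natcpow.

(** * Passage to the limit and the final identity *)

(** The [N]-th partial sum for [g] is the one for [h] at [N./2], and [N./2] tends to infinity. *)
Lemma cvg_series_even (K : numFieldType) (g h : nat -> K) (l : K) :
  (forall n, odd n -> g n = 0) -> (forall n, g (2 * n)%N = h n) ->
  series (fun n => h n.+1 : K^o) @ \oo --> (l : K^o) ->
  series (fun n => g n.+1 : K^o) @ \oo --> (l : K^o).
Proof.
move=> g_odd g_even hl.
have -> : series (fun n => g n.+1 : K^o) = (series (fun n => h n.+1 : K^o)) \o half.
  apply/funext => N; rewrite /series /=; elim: N => [|N IH]; first by rewrite !big_nil.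
  rewrite big_nat_recr //= IH uphalf_half; case: (boolP (odd N)) => oN.
    rewrite add1n big_nat_recr //= -g_even; congr (_ + g _); lia.
  by rewrite g_odd ?addr0.
apply: cvg_comp hl => A [n _ nA]; exists n.*2 => // N /= nN.
by apply: nA => /=; lia.
Qed.

Lemma cvgB_unique (K : numFieldType) (u v p q : nat -> K^o) (a b c d : K^o) :
  (forall n, u n - v n = p n - q n) ->
  u @ \oo --> a -> v @ \oo --> b -> p @ \oo --> c -> q @ \oo --> d ->
  a - b = c - d.
Proof.
move=> uvpq ua vb pc qd.
have uv : (u - v) @ \oo --> a - b by exact: cvgB.
have pq : (p - q) @ \oo --> c - d by exact: cvgB.
have E : u - v = p - q by apply/funext => n; exact: uvpq.
by rewrite -(cvg_lim (@norm_hausdorff K K^o) uv) E (cvg_lim _ pq).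
Qed.

Lemma csum_cvg_ext (R : realType) (u v : nat -> R[i]) :
  (forall n, (0 < n)%N -> u n = v n) -> csum_cvg u <-> csum_cvg v.
Proof.
move=> uv; rewrite /csum_cvg.
by have -> : (fun n => u n.+1 : R[i]^o) = (fun n => v n.+1) by apply/funext => n; rewrite uv.
Qed.

Theorem theorem6 (R : realType) (k : nat) (x : R) (s : R[i])
    (hx : `|k%:R * x| < 1) (hs : 1 < complex.Re s) :
  [/\ csum_cvg (zeta_term s),
      csum_cvg (zeta1_even_term x k s),
      csum_cvg (polylog_term s (k%:R ^+ 2 * x ^+ 2)%:C),
      csum_cvg (polylog_term s (k%:R * x)%:C) &
      zeta s * zeta1_even x k s =
        (polylog s (k%:R ^+ 2 * x ^+ 2)%:C - polylog s (k%:R * x)%:C)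
          / (natcpow 2 s - 1)].
Proof.
pose y := k%:R * x; have y1 : `|y| < 1 := hx.
pose a n := \sum_(d <- divisors n) (mobius (n %/ d))%:~R * y ^+ d.
have a_le n : (0 < n)%N -> `|(a n)%:C| <= ((1 - `|y|)^-1)%:C.
  by move=> n0; rewrite normc_def /= expr0n addr0 sqrtr_sqr lecR norm_sum_mobius_exp_le.
pose w := natcpow 2 s; have w0 : w != 0 by exact: natcpow_neq0.
(* Over all [n >= 1], [g] sums to [2^s] times the even zeta value and [h] to that value itself; zero
   odd coefficients in [h] give both the same indexing for the product with zeta. *)
pose g n := (a (2 * n)%N)%:C / natcpow n s.
pose h n := (if ~~ odd n then (a n)%:C else 0) / natcpow n s.
have ng : csum_cvg (fun n => `|g n|).
  apply: (is_cvg_dirichlet_series (C := (1 - `|y|)^-1) _ _).2 => // n n0.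
  by rewrite a_le // muln_gt0.
have nh : csum_cvg (fun n => `|h n|).
  apply: (is_cvg_dirichlet_series (C := (1 - `|y|)^-1) _ _).2 => // n n0.
  case: ifP => _; first exact: a_le.
  by rewrite normr0 lecR invr_ge0 subr_ge0 ltW.
have zetaE n : (0 < n)%N -> zeta_term s n = 1 / natcpow n s by rewrite mul1r.
have evenE n : (0 < n)%N -> zeta1_even_term x k s n = h (2 * n)%N.
  move=> n0; have n20 : (0 < 2 * n)%N by rewrite muln_gt0.
  rewrite /zeta1_even_term natcpowB1 // /h oddM /= /Lpoly.
  have -> : \sum_(d <- divisors (2 * n)) (mobius (2 * n %/ d))%:~R * k%:R ^+ d * x ^+ d
     = a (2 * n)%N by apply: eq_bigr => d _; rewrite exprMn mulrA.
  have D0 : (2 * n)%N%:R != 0 :> R[i] by rewrite pnatr_eq0 -lt0n.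
  by rewrite rmorphM fmorphV rmorph_nat invfM invrK mulrC mulrA mulfK // mulrC.
have cpoly z : `|z| < 1 -> csum_cvg (polylog_term s z%:C).
  move=> z1; apply: (is_cvg_dirichlet_series (C := 1) _ _).1 => // n _.
  rewrite -rmorphXn normc_def /= expr0n addr0 sqrtr_sqr lecR normrX.
  by rewrite exprn_ile1 // ltW.
have czeta : csum_cvg (zeta_term s).
  apply/(csum_cvg_ext zetaE); apply: (is_cvg_dirichlet_series (C := 1) _ _).1 => // n _.
  by rewrite normr1.
have kx2 : k%:R ^+ 2 * x ^+ 2 = y ^+ 2 by rewrite exprMn.
have cp2 : csum_cvg (polylog_term s (k%:R ^+ 2 * x ^+ 2)%:C).
  by apply: cpoly; rewrite kx2 normrX exprn_ilt1.
have gE n : (0 < n)%N -> w * zeta1_even_term x k s n = g n.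
  move=> n0; rewrite evenE // /h oddM /= natcpowM // /g invfM mulrCA; congr (_ * _).
  by rewrite mulrA divff // mul1r.
have ceven : csum_cvg (zeta1_even_term x k s).
  apply/(csum_cvg_ext (v := fun n => (a (2 * n)%N)%:C / w / natcpow n s)) => [n n0|].
    by apply: (mulfI w0); rewrite gE // /g mulrA [w * _]mulrCA divff // mulr1.
  (* The bound on [a] is divided by the modulus of [w], since [(2n)^s = w n^s]. *)
  apply: (is_cvg_dirichlet_series (C := (1 - `|y|)^-1 / 2 `^ complex.Re s) _ _).1 => // n n0.
  rewrite normrM normfV normc_natcpow // -fmorphV rmorphM ler_wpM2r ?a_le ?muln_gt0 //.
  by rewrite lecR invr_ge0 powR_ge0.
split; [exact: czeta | exact: ceven | exact: cp2 | exact: cpoly |].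
pose L (u : nat -> R[i]) := series (fun n => u n.+1 : R[i]^o).
have gL : L g @ \oo --> (w * zeta1_even x k s : R[i]^o).
  rewrite (_ : L g = (fun N => w * L (zeta1_even_term x k s) N)).
    exact: (@cvgMl_regular R[i]).
  by apply/funext => N; rewrite /L /series /= mulr_sumr; apply: eq_bigr => n _; rewrite gE.
have hL : L h @ \oo --> (zeta1_even x k s : R[i]^o).
  apply: (@cvg_series_even R[i] h (fun n => h (2 * n)%N)) => [n on|n|].
  - by rewrite /h on mul0r.
  - by [].
  - rewrite (_ : (fun n => h (2 * n.+1)%N) = (fun n => zeta1_even_term x k s n.+1)).
      exact: ceven.
    by apply/funext => n; rewrite evenE.
have gz := @cvg_dirichlet R[i] g (zeta_term s) _ _ ng gL czeta.
have hz := @cvg_dirichlet R[i] h (zeta_term s) _ _ nh hL czeta.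
have key : w * zeta1_even x k s * zeta s - zeta1_even x k s * zeta s =
    polylog s (k%:R ^+ 2 * x ^+ 2)%:C - polylog s (k%:R * x)%:C.
  apply: (@cvgB_unique R[i] _ _ _ _ _ _ _ _ _ gz hz cp2 (cpoly y y1)) => N.
  rewrite /series /= -!sumrB; apply: eq_bigr => n _.
  rewrite !sum_dirichlet_natcpow // /polylog_term kx2 -!rmorphXn -!mulrBl; congr (_ / _).
  (* [big_mkcond] read backwards turns the zero coefficients of [h] into a restriction to even
     divisors; inversion is then applied at [2 * n.+1] and at [n.+1]. *)
  by rewrite -big_mkcond -!rmorph_sum -!rmorphB sum_even_divisors // !mobius_inversion // exprM.
have w1 : w - 1 != 0 by rewrite subr_eq0 natcpow2_neq1.
by apply: (mulIf w1); rewrite divfK // -key; ring.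
Qed.
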